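(* There exist infinitely many virtual knots $K$ with unknotting index $U(K)=(1,0)$.
   Context: A virtual knot diagram is a generic immersion of one circle in the plane whose double points are each marked either as a classical crossing (with over/under information) or as a virtual crossing (no over/under information). Two diagrams are equivalent if they are related by a finite sequence of classical Reidemeister moves RI, RII, RIII, virtual Reidemeister moves VRI, VRII, VRIII (the analogues of RI, RII, RIII in which all crossings are virtual), and the semi-virtual move SV (moving an arc having only virtual crossings across a classical crossing), together with planar isotopy. A virtual knot $K$ is an equivalence class of virtual knot diagrams; $[K]$ denotes the set of its diagrams. The trivial knot is the class of the crossingless circle. Virtualizing a classical crossing means replacing it by a virtual crossing; a crossing change means exchanging the over and under strands at a classical crossing. For non-negative integers $n,m$, a virtual knot diagram $D$ is $(n,m)$-unknottable if, by virtualizing $n$ classical crossings of $D$ and applying crossing changes at $m$ classical crossings of $D$, one obtains a diagram of the trivial knot. The unknotting index $U(D)$ of the diagram $D$ is the minimum, in the dictionary (lexicographic) order, of all pairs $(n,m)$ such that $D$ is $(n,m)$-unknottable. The unknotting index of a virtual knot $K$ is $U(K)=\min\{U(D) : D\in [K]\}$, the minimum again being taken in the dictionary order. *)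

(* Defs.v *)
(* Virtual knot diagrams in the plane, encoded combinatorially.

   A generic immersed circle is recorded by travelling once around it and
   writing down the double points met on the way.  A passage (c, s) through
   the double point c has s = true when the other strand crosses the
   travelling strand from its left to its right, and s = false when it
   crosses from right to left.  The cyclic word of passages determines the
   4-valent map cut out by the curve on an oriented surface; the curve lies
   on the sphere when the Euler characteristic of this map is 2.  The curve
   lies in the plane once the unbounded region is specified: by convention
   that region is on the right of the edge running from the last letter of
   the word back to the first one.  Virtual crossings are double points like
   the classical ones, and planarity takes all of them into account. *)
From mathcomp Require Import all_boot all_order.
From mathcomp Require Import classical_sets cardinality.
From Stdlib Require Import Relations.
Set Implicit Arguments.
Unset Strict Implicit.
Unset Printing Implicit Defensive.

Definition passage := (nat * bool)%type.

(* The other passage through the same double point: if B crosses A from left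
   to right, then A crosses B from right to left. *)
Definition opp (p : passage) : passage := (p.1, ~~ p.2).

(* The dart (p, true) is the edge leaving p forwards and (p, false) the edge
   leaving p backwards.  Walking along d with a region on the right-hand side,
   one turns right at the end of d, and [turn f d] is the dart taken then. *)
Definition dart := (passage * bool)%type.

Definition turn (f : seq passage) (d : dart) : dart :=
  let p := if d.2 then next f d.1 else prev f d.1 in (opp p, p.2 == d.2).

Definition darts (f : seq passage) : seq dart :=
  [seq (p, b) | p <- f, b <- [:: true; false]].

(* The boundary of the region on the right of d; size (darts f) steps are
   enough to go all the way around. *)
Definition face (f : seq passage) (d : dart) : seq dart :=
  traject (turn f) d (size (darts f)).

(* Each region is counted through the first dart of its boundary. *)
Definition nfaces (f : seq passage) : nat :=
  size (undup [seq find (mem (face f d)) (darts f) | d <- darts f]).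

(* V - E + F = 2 with V = N, E = 2 * N and size f = 2 * N; the empty word is
   the embedded circle. *)
Definition planar (f : seq passage) : bool :=
  nilp f || (nfaces f == (size f)./2 + 2).

(* A letter is a passage marked as over, under or virtual. *)
Definition level := option bool.
Definition Over : level := Some true.
Definition Under : level := Some false.
Definition Virt : level := None.

Definition letter := (passage * level)%type.
Definition crossing (x : letter) : nat := x.1.1.
Definition side (x : letter) : bool := x.1.2.
Definition lev (x : letter) : level := x.2.
Definition bar (x : letter) : letter := (opp x.1, omap negb x.2).

Definition word := seq letter.
Definition shadow (w : word) : seq passage := [seq x.1 | x <- w].

(* Every double point is passed exactly twice, by opposite passages, which
   are either over and under or both virtual. *)
Definition well_marked (w : word) : bool :=
  uniq (shadow w) && all (fun x => bar x \in w) w.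

Record diagram := Diagram {
  code :> word;
  code_marked : well_marked code;
  code_planar : planar (shadow code) }.

(* Planar isotopy: two words describe the same plane curve when they differ
   by the names of the double points, the edge chosen on the boundary of the
   unbounded region, and the direction of travel. *)
Inductive isotopy : word -> word -> Prop :=
| Relabel (g : nat -> nat) w :
    injective g ->
    isotopy w [seq ((g x.1.1, x.1.2), x.2) | x <- w]
| Rebase u v x y :
    (x.1, true) \in face (shadow (rcons u x ++ rcons v y)) (y.1, true) ->
    isotopy (rcons u x ++ rcons v y) (rcons v y ++ rcons u x)
| Reverse u v x :
    (x.1, false) \in face (shadow (u ++ x :: v)) ((last x v).1, true) ->
    isotopy (u ++ x :: v) (rev u ++ rev (x :: v)).

Inductive add_monogon (x : letter) : word -> word -> Prop :=
| AddMonogon u v : add_monogon x (u ++ v) (u ++ [:: x; bar x] ++ v).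

(* One strand passes x then y; the other one runs parallel or antiparallel to
   it.  As the two strands cross back and forth, the sides at x and y differ,
   and this makes the two edges between x and y bound a region. *)
Inductive add_bigon (x y : letter) : word -> word -> Prop :=
| AddParallel u v t :
    side x != side y ->
    add_bigon x y (u ++ v ++ t)
      (u ++ [:: x; y] ++ v ++ [:: bar x; bar y] ++ t)
| AddAntiparallel u v t :
    side x != side y ->
    add_bigon x y (u ++ v ++ t)
      (u ++ [:: x; y] ++ v ++ [:: bar y; bar x] ++ t).

Definition strand (o : bool) (a b : letter) : word :=
  if o then [:: a; b] else [:: b; a].

(* Going clockwise around a triangular region with vertices X, Y, Z, the edge
   XY lies on the strand passing x at X and y at Y, the edge YZ on the strand
   passing bar y at Y and z at Z, the edge ZX on the strand passing bar z at Z
   and bar x at X; o1, o2, o3 tell whether these strands run clockwise.  The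
   equations say that [turn] goes from each edge to the following one.  The
   move reverses the order of the two crossings on each strand. *)
Inductive flip_triangle (x y z : letter) : word -> word -> Prop :=
| FlipTriangle (o1 o2 o3 : bool) u0 u1 u2 u3 (a b c : word) :
    o2 = (side y == o1) ->
    o3 = (side z == o2) ->
    o1 = (side (bar x) == o3) ->
    perm_eq [:: a; b; c]
      [:: strand o1 x y; strand o2 (bar y) z; strand o3 (bar z) (bar x)] ->
    flip_triangle x y z
      (u0 ++ a ++ u1 ++ b ++ u2 ++ c ++ u3)
      (u0 ++ rev a ++ u1 ++ rev b ++ u2 ++ rev c ++ u3).

(* In RIII the levels of y, z and bar x say respectively whether the first
   strand is over the second one, the second over the third, and the third
   over the first: the move requires a top, a middle and a bottom strand. *)
Inductive move (w w' : word) : Prop :=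
| Isotopy of isotopy w w'
| RI x of lev x != Virt & add_monogon x w w'
| VRI x of lev x = Virt & add_monogon x w w'
| RII x y of lev x != Virt & lev x = lev y & add_bigon x y w w'
| VRII x y of lev x = Virt & lev y = Virt & add_bigon x y w w'
| RIII x y z of
    [/\ lev x != Virt, lev y != Virt & lev z != Virt] &
    ~ (lev y = lev z /\ lev z = lev (bar x)) &
    flip_triangle x y z w w'
| VRIII x y z of
    [/\ lev x = Virt, lev y = Virt & lev z = Virt] &
    flip_triangle x y z w w'
| SV x y z of
    [/\ lev x != Virt, lev y = Virt & lev z = Virt] &
    flip_triangle x y z w w'.

Definition equivalent : diagram -> diagram -> Prop :=
  clos_refl_sym_trans diagram (fun D D' => move (code D) (code D')).

Definition circle : diagram := @Diagram [::] isT isT.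

Local Open Scope classical_set_scope.

Definition virtual_knot (K : set diagram) : Prop :=
  exists D, K = [set D' | equivalent D D'].

Definition trivial_knot : set diagram := [set D | equivalent circle D].

Definition classical_crossings (w : word) : seq nat :=
  [seq crossing x | x <- w & lev x == Over].

(* Virtualize the crossings in S and change those in T. *)
Definition modify_letter (S T : seq nat) (x : letter) : letter :=
  (x.1, if crossing x \in S then Virt
        else if crossing x \in T then omap negb (lev x) else lev x).

Definition modify_word (S T : seq nat) (w : word) : word :=
  map (modify_letter S T) w.

Lemma modify_marked S T w : well_marked w -> well_marked (modify_word S T w).
Proof.
case/andP=> uw /allP bw; apply/andP; split.
  by rewrite /shadow /modify_word -map_comp.
apply/allP=> _ /mapP[x xw ->].
suff -> : bar (modify_letter S T x) = modify_letter S T (bar x).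
  by apply: map_f; apply: bw.
rewrite /bar /modify_letter /crossing /lev /=.
by case: ifP => //; case: ifP.
Qed.

Lemma modify_planar S T w :
  planar (shadow w) -> planar (shadow (modify_word S T w)).
Proof. by rewrite /shadow /modify_word -map_comp. Qed.

Definition modify (S T : seq nat) (D : diagram) : diagram :=
  Diagram (modify_marked S T (code_marked D))
          (modify_planar S T (code_planar D)).

Definition unknottable (D : diagram) (n m : nat) : Prop :=
  exists S T : seq nat,
    [/\ size S = n, size T = m, uniq (S ++ T),
        {subset S ++ T <= classical_crossings D}
      & trivial_knot (modify S T D)].

(* Pairs in dictionary order. *)
Definition least (A : set (nat *l nat)) (p : nat *l nat) : Prop :=
  A p /\ forall q, A q -> (p <= q)%O.

(* [diagram_index D p] is U(D) = p and [unknotting_index K p] is U(K) = p. *)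
Definition diagram_index (D : diagram) (p : nat *l nat) : Prop :=
  least [set q | unknottable D q.1 q.2] p.

Definition unknotting_index (K : set diagram) (p : nat *l nat) : Prop :=
  least [set q | exists2 D, K D & diagram_index D q] p.

(* Main.v *)
(* Changing crossings of a virtual knot diagram does not affect the flat Gauss
   word, the cyclic word of the classical passages with their sides.  Turaev's
   u-polynomial of this word (the sum over the crossings of an odd function of
   their intersection index) is invariant under all moves up to sign, the sign
   coming from the reversal of the curve.  A virtual knot with a non-zero
   u-polynomial therefore cannot be unknotted by crossing changes alone.

   The examples: let a curve spiral inwards through n + 1 turns, leave the
   centre along a spoke crossing the turns at e_n, ..., e_0, and push a finger
   of the outer arc across the turns into the centre.  Let the e_j and the
   first crossing c of the finger with the innermost turn be classical, and
   all the other crossings of the finger virtual.  The Gauss word is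
   c e_0 ... e_n c e_n ... e_0, with all sides aligned, so the index of c is
   n + 1 up to sign while that of each e_j is 1 up to sign: the terms of degree
   at least 2 of the u-polynomial tell these knots apart.  Once c is
   virtualized the finger is pulled back by virtual moves VRII, and the loops
   of the spiral vanish by moves RI. *)
From mathcomp Require Import all_boot all_order all_algebra.
From mathcomp Require Import zify.
From mathcomp Require Import classical_sets cardinality.
From Stdlib Require Import Relations.
Require Import Defs.

Set Implicit Arguments.
Unset Strict Implicit.
Unset Printing Implicit Defensive.

Import GRing.Theory.

(** * The u-polynomial of a Gauss word *)

Lemma oppK : involutive opp.
Proof. by case=> c s; rewrite /opp /= negbK. Qed.

Definition gauss_code (g : seq passage) : bool :=
  uniq g && all (fun p => opp p \in g) g.

Lemma gauss_code_perm g g' : perm_eq g g' -> gauss_code g = gauss_code g'.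
Proof.
move=> pg; rewrite /gauss_code (perm_uniq pg) (perm_all _ pg); congr andb.
by apply: eq_all => p; rewrite (perm_mem pg).
Qed.

Section Heights.
Implicit Types (p q : passage) (g u v t : seq passage).
Local Open Scope ring_scope.

Definition sgn p : int := if p.2 then 1 else -1.

Definition balance g : int := \sum_(p <- g) sgn p.

Fixpoint height g p : int :=
  if g is q :: g' then (if q == p then 0 else sgn q + height g' p) else 0.

Lemma sgn_opp p : sgn (opp p) = - sgn p.
Proof. by case: p => c []. Qed.

Lemma balance_cat u v : balance (u ++ v) = balance u + balance v.
Proof. exact: big_cat. Qed.

Lemma balance_perm u v : perm_eq u v -> balance u = balance v.
Proof. exact: perm_big. Qed.

Lemma balance_cons p u : balance (p :: u) = sgn p + balance u.
Proof. exact: big_cons. Qed.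

Lemma balance_rev u : balance (rev u) = balance u.
Proof. by apply: balance_perm; rewrite perm_rev. Qed.

Lemma balance_map_opp u : balance (map opp u) = - balance u.
Proof.
rewrite /balance big_map -sumrN; apply: eq_bigr => p _; exact: sgn_opp.
Qed.

(** The involution [opp] permutes the word and negates every sign. *)
Lemma balance0 g : gauss_code g -> balance g = 0.
Proof.
case/andP=> ug /allP opg.
have : perm_eq g (map opp g).
  have uo : uniq (map opp g) by rewrite (map_inj_uniq (inv_inj oppK)).
  apply: uniq_perm => // p.
  apply/idP/mapP => [pg | [q qg ->]]; last exact: opg.
  by exists (opp p); rewrite ?oppK ?opg.
by move=> /balance_perm; rewrite balance_map_opp => ?; lia.
Qed.

Lemma height_cat u v p :
  height (u ++ v) p = if p \in u then height u p else balance u + height v p.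
Proof.
elim: u => [|q u IH] /=; first by rewrite /balance big_nil add0r.
rewrite in_cons eq_sym; case: eqP => //= _.
by rewrite IH /balance big_cons; case: ifP => // _; rewrite addrA.
Qed.

Lemma height_mid u p v : uniq (u ++ p :: v) -> height (u ++ p :: v) p = balance
  u.
Proof.
rewrite cat_uniq => /and3P[_ /= /norP[/negbTE nu _] _].
by rewrite height_cat nu /= eqxx addr0.
Qed.

Lemma height_insert u x v p : p \notin x -> balance x = 0 ->
  height (u ++ x ++ v) p = height (u ++ v) p.
Proof. by move=> /negbTE px x0; rewrite !height_cat px x0 add0r. Qed.

Lemma height_rev g p : uniq g -> p \in g ->
  height (rev g) p = balance g - height g p - sgn p.
Proof.
elim: g => //= q g IH /andP[qg ug]; rewrite in_cons rev_cons -cats1 height_cat.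
rewrite mem_rev balance_cons => /orP[/eqP->|pg].
  by rewrite (negbTE qg) /= eqxx balance_rev; lia.
rewrite pg IH // [q == p]negbTE; last by apply: contraNneq qg => ->.
lia.
Qed.

(* The signs of a Gauss word add up to 0, so this difference of heights is the
   sum of the signs met on the way from p to opp p, even when that way passes
   the base point of the word.  It is meant for p.2 = true. *)
Definition chord_index g p : int := height g (opp p) - height g p - 1.

End Heights.

Section UPolynomial.
Implicit Types (p q : passage) (g u v t : seq passage).
Local Open Scope ring_scope.
Variable phi : int -> int.
Hypothesis phiN : forall z, phi (- z) = - phi z.

(** Each crossing contributes once, through its passage with side [true]. An arbitrary odd [phi]
    stands for all the coefficients of Turaev's polynomial at once; a suitable [phi] recovers a
    single one. *)
Definition upoly g : int := \sum_(p <- g | p.2) phi (chord_index g p).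

Lemma phi_cancel a b : a + b = 0 -> phi a + phi b = 0.
Proof. by move=> /eqP; rewrite addr_eq0 => /eqP->; rewrite phiN addNr. Qed.

Lemma phi0 : phi 0 = 0.
Proof. by move: (phi 0) (phi_cancel (addr0 0)) => z; lia. Qed.

Lemma upoly_perm g g' : perm_eq g' g ->
  {in g, forall p, chord_index g' p = chord_index g p} -> upoly g' = upoly g.
Proof.
move=> pg eqi; rewrite /upoly (perm_big _ pg) big_seq_cond [RHS]big_seq_cond.
by apply: eq_bigr => p /andP[pin _]; rewrite eqi.
Qed.

(** Common step for inserting a monogon or a bigon. Since [g] is closed under [opp], both heights
    entering the index of an old chord are unchanged. *)
Lemma upoly_extend n g g' : perm_eq g' (n ++ g) -> gauss_code g ->
  {in g, forall p, height g' p = height g p} ->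
  upoly g' = \sum_(p <- n | p.2) phi (chord_index g' p) + upoly g.
Proof.
move=> pg /andP[_ /allP og] eqh; rewrite {1}/upoly (perm_big _ pg) big_cat /=.
congr (_ + _); rewrite big_seq_cond /upoly [RHS]big_seq_cond.
by apply: eq_bigr => p /andP[pin _]; rewrite /chord_index !eqh ?og.
Qed.

Lemma upoly_relabel (h : nat -> nat) g : injective h ->
  upoly [seq (h p.1, p.2) | p <- g] = upoly g.
Proof.
move=> hI; pose H p : passage := (h p.1, p.2).
have HI : injective H by move=> [a b] [c d] [/hI-> ->].
have hH p : height (map H g) (H p) = height g p.
  by elim: g => //= q g ->; rewrite (inj_eq HI).
rewrite /upoly big_map; apply: eq_bigr => p _; rewrite /chord_index.
by rewrite -[opp _]/(H (opp p)) -/(H p) !hH.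
Qed.

(** As the total balance is 0, moving the base point shifts every height by the same constant, which
    cancels in each index. *)
Lemma upoly_rot u v : gauss_code (u ++ v) -> upoly (v ++ u) = upoly (u ++ v).
Proof.
move=> guv; have t0 := balance0 guv; rewrite balance_cat in t0.
case/andP: guv => uuv /allP ouv.
have hr p : p \in u ++ v ->
    height (v ++ u) p = height (u ++ v) p - balance u.
  rewrite mem_cat !height_cat => /orP[] pu.
    have := uuv; rewrite cat_uniq => /and3P[_ /hasPn/(_ p) h _].
    by rewrite pu ifN; [lia | apply: contraL pu => /h].
  have := uuv; rewrite cat_uniq => /and3P[_ /hasPn/(_ p pu)/= h _].
  by rewrite pu (negbTE h); lia.
apply: upoly_perm => [|p pg]; first by rewrite perm_catC.
by rewrite /chord_index !hr ?ouv //; lia.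
Qed.

(** Reversal negates each index exactly: the signs of [p] and [opp p] contribute 2, which turns the
    correction [- 1] of [chord_index] into [+ 1]. *)
Lemma upoly_rev g : gauss_code g -> upoly (rev g) = - upoly g.
Proof.
move=> gg; have t0 := balance0 gg; case/andP: gg => ug /allP og.
rewrite /upoly (perm_big g) ?perm_rev //= -sumrN.
rewrite big_seq_cond [RHS]big_seq_cond; apply: eq_bigr => p /andP[pg p2].
rewrite -phiN; congr phi;
  rewrite /chord_index !height_rev ?og // t0 sgn_opp /sgn p2.
lia.
Qed.

(** The inserted pair has balance 0, so old heights persist; the new chord has index 0, where an odd
    function vanishes. *)
Lemma upoly_insert1 u v x :
  uniq (u ++ [:: x; opp x] ++ v) -> gauss_code (u ++ v) ->
  upoly (u ++ [:: x; opp x] ++ v) = upoly (u ++ v).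
Proof.
move=> ug gg.
have pg : perm_eq (u ++ [:: x; opp x] ++ v) ([:: x; opp x] ++ u ++ v).
  by rewrite perm_catCA.
have nx p : p \in u ++ v -> p \notin [:: x; opp x].
  move: ug; rewrite (perm_uniq pg) cat_uniq => /and3P[_ /hasPn h _].
  by move=> /h.
have t0 : balance [:: x; opp x] = 0.
  by rewrite /balance !big_cons big_nil sgn_opp; lia.
have hx : height (u ++ [:: x; opp x] ++ v) x = balance u.
  by rewrite height_mid.
have hox : height (u ++ [:: x; opp x] ++ v) (opp x) = balance u + sgn x.
  have E : u ++ [:: x; opp x] ++ v = (u ++ [:: x]) ++ opp x :: v.
    by rewrite -catA.
  by rewrite E in ug *; rewrite height_mid // balance_cat /balance big_seq1.
rewrite (upoly_extend pg gg) => [|p pin]; last by rewrite height_insert ?nx.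
rewrite -[RHS]add0r; congr (_ + _); rewrite !big_cons big_nil /chord_index oppK.
rewrite hx hox.
case: x {ug pg nx t0 hx hox} => c [] /=; rewrite addr0 -phi0; congr phi;
  rewrite /sgn /=; lia.
Qed.

(** Opposite sides make both inserted blocks balanced, so old heights persist, and give the two new
    chords opposite indices, whose contributions cancel. *)
Lemma upoly_insert2 u v t x y (z := opp x) (w := opp y) (b : bool)
    (s := if b then [:: z; w] else [:: w; z]) : x.2 != y.2 ->
  uniq (u ++ [:: x; y] ++ v ++ s ++ t) -> gauss_code (u ++ v ++ t) ->
  upoly (u ++ [:: x; y] ++ v ++ s ++ t) = upoly (u ++ v ++ t).
Proof.
move=> xy ug gg.
have pg : perm_eq (u ++ [:: x; y] ++ v ++ s ++ t)
    (([:: x; y] ++ s) ++ u ++ v ++ t).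
  apply/permP=> a; rewrite !count_cat; lia.
have xy0 : sgn x + sgn y = 0.
  by case: (x) (y) xy => c [] [c' []].
have tx : balance [:: x; y] = 0 by rewrite /balance !big_cons big_nil addr0.
have ts : balance s = 0.
  rewrite /s /balance; case: b @s ug pg => s ug pg;
    rewrite !big_cons big_nil !sgn_opp; lia.
have nx p : p \in u ++ v ++ t -> (p \notin [:: x; y]) /\ (p \notin s).
  move: ug; rewrite (perm_uniq pg) cat_uniq => /and3P[_ /hasPn h _].
  by move=> /h pn; apply/norP; rewrite -mem_cat.
have hold p : p \in u ++ v ++ t ->
    height (u ++ [:: x; y] ++ v ++ s ++ t) p = height (u ++ v ++ t) p.
  move=> /nx[px ps]; rewrite height_insert //.
  by rewrite !(catA u) height_insert // -catA.
rewrite (upoly_extend pg gg hold).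
rewrite -[RHS]add0r; congr (_ + _).
set g := u ++ _ in ug *.
have hx : height g x = balance u by rewrite /g height_mid.
have hy : height g y = balance u + sgn x.
  have E : g = (u ++ [:: x]) ++ y :: v ++ s ++ t by rewrite /g -!catA.
  by rewrite E in ug *; rewrite height_mid // balance_cat /balance big_seq1.
(* The second block starts at height [r], since [x] and [y] cancel before it. *)
pose r := balance u + balance v.
have h1 c d : s = [:: c; d] -> height g c = r /\ height g d = r + sgn c.
  move=> Es.
  have E : g = (u ++ [:: x; y] ++ v) ++ c :: d :: t by rewrite /g Es -!catA.
  have E' : g = (u ++ [:: x;
    y] ++ v ++ [:: c]) ++ d :: t by rewrite /g Es -!catA.
  split; first by rewrite E in ug *;
    rewrite height_mid // !balance_cat tx add0r.
  rewrite E' in ug *; rewrite height_mid // !balance_cat tx add0r.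
  by rewrite [balance [:: c]]big_seq1 /r addrA.
have [hz hw] : height g z = r + (if b then 0 else sgn w) /\
    height g w = r + (if b then sgn z else 0).
  rewrite /s in h1; case: (b) h1 => h1; have [-> ->] := h1 _ _ erefl;
  by rewrite addr0.
have sz : sgn z = - sgn x := sgn_opp x.
have sw : sgn w = - sgn y := sgn_opp y.
have zw : perm_eq s [:: z; w].
  by rewrite /s; case: (b) => //; rewrite (perm_catC [:: w] [:: z]).
rewrite big_cat /= (perm_big _ zw) /= !big_cons !big_nil /chord_index.
rewrite [opp z]oppK [opp w]oppK -/z -/w hx hy hz hw.
have -> : z.2 = ~~ x.2 by [].
have -> : w.2 = ~~ y.2 by [].
move: xy sz sw; rewrite /sgn; case: (x.2); case: (y.2) => //= _ -> ->;
  rewrite !addr0 ?add0r; apply: phi_cancel; case: (b); lia.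
Qed.

(** The change of height of [p] when the block [s] is reversed in place. Passages outside [s] keep
    their height because reversal preserves the balance of [s]. *)
Definition swap_shift (s : seq passage) p : int :=
  if p \in s then height (rev s) p - height s p else 0.

Lemma height_flip u0 u1 u2 u3 a b c p :
  uniq (u0 ++ a ++ u1 ++ b ++ u2 ++ c ++ u3) ->
  height (u0 ++ rev a ++ u1 ++ rev b ++ u2 ++ rev c ++ u3) p =
  height (u0 ++ a ++ u1 ++ b ++ u2 ++ c ++ u3) p
  + \sum_(s <- [:: a; b; c]) swap_shift s p.
Proof.
move=> ug; have := leq_b1 (p \in u0 ++ a ++ u1 ++ b ++ u2 ++ c ++ u3).
rewrite -(count_uniq_mem p ug) !count_cat.
have lec s : (p \in s <= count_mem p s)%N by rewrite -has_pred1 has_count;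
  case: count.
move: (lec u0) (lec a) (lec u1) (lec b) (lec u2) (lec c) =>
  l0 la l1 lb l2 lc le1.
rewrite !big_cons big_nil addr0 /swap_shift !height_cat !mem_rev !balance_rev.
(* By uniqueness [p] lies in at most one piece, which leaves seven of the 64 membership patterns. *)
have : ((p \in u0) + (p \in a) + (p \in u1) + (p \in b) + (p \in u2) + (p \in
  c) <= 1)%N.
  apply: leq_trans le1; rewrite -!addnA; do ?apply: leq_add => //.
  exact: leq_trans lc (leq_addr _ _).
case: (p \in u0) (p \in a) (p \in u1) (p \in b) (p \in u2) (p \in c)
  => [] [] [] [] [] [] //= _ {l0 la l1 lb l2 lc le1 lec ug}; lia.
Qed.

Definition segment (o : bool) p q := if o then [:: p; q] else [:: q; p].

Lemma perm_segment o p q : perm_eq (segment o p q) [:: p; q].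
Proof. by case: o; rewrite // (perm_catC [:: q] [:: p]). Qed.

Lemma swap_shift_segment o p q r : p != q ->
  let d := (if r == p then sgn q else 0) - (if r == q then sgn p else 0) in
  swap_shift (segment o p q) r = if o then d else - d.
Proof.
move=> pq /=; rewrite /swap_shift; case: o; rewrite !inE /= -!(eq_sym r).
  case: eqP => [->|_] /=; first by rewrite (negbTE pq); lia.
  by case: eqP => //= _; lia.
case: (eqVneq r p) => [->|_] /=; first by rewrite (negbTE pq) /=; lia.
by case: eqP => //= _; lia.
Qed.

(** Read [o1], [o2], [o3] as signs e1, e2, e3. The three equations say e2 = e1 * [sgn y], e3 = e2 *
    [sgn z] and e1 = - e3 * [sgn x]. It follows that both passages at [x] are shifted by e2, both at
    [y] by e3 and both at [z] by e1: at each vertex, the sign of the opposite strand. Hence no index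
    changes. *)
Lemma upoly_flip (x y z : passage) (o1 o2 o3 : bool) u0 u1 u2 u3 a b c :
  o2 = (y.2 == o1) -> o3 = (z.2 == o2) -> o1 = ((opp x).2 == o3) ->
  perm_eq [:: a; b; c] [:: segment o1 x y; segment o2 (opp y) z;
                           segment o3 (opp z) (opp x)] ->
  uniq (u0 ++ a ++ u1 ++ b ++ u2 ++ c ++ u3) ->
  upoly (u0 ++ rev a ++ u1 ++ rev b ++ u2 ++ rev c ++ u3) =
  upoly (u0 ++ a ++ u1 ++ b ++ u2 ++ c ++ u3).
Proof.
move=> e2 e3 e1 pabc ug; apply: upoly_perm => [|p _].
  by apply/permP=> i; rewrite !count_cat !count_rev.
rewrite /chord_index !height_flip // !(perm_big _ pabc) /=.
pose shift q := \sum_(s <- [:: segment o1 x y; segment o2 (opp y) z;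
                                segment o3 (opp z) (opp x)]) swap_shift s q.
rewrite -/(shift p) -/(shift (opp p)).
suff -> : shift (opp p) = shift p by rewrite opprD addrACA subrr addr0.
have : uniq [:: x; y; opp y; z; opp z; opp x].
  have pabc' : perm_eq (a ++ b ++ c) [:: x; y; opp y; z; opp z; opp x].
    have := perm_flatten pabc; rewrite /= !cats0 => /perm_trans; apply.
    rewrite -[[:: x; y; _; _; _; _]]/([:: x; y] ++ [:: opp y; z] ++ [:: opp z;
      opp x]).
    by do ![apply: perm_cat | apply: perm_segment].
  rewrite -(perm_uniq pabc');
    have : perm_eq (u0 ++ a ++ u1 ++ b ++ u2 ++ c ++ u3)
    ((a ++ b ++ c) ++ u0 ++ u1 ++ u2 ++ u3).
    by apply/permP=> i; rewrite !count_cat; lia.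
  by move/perm_uniq; rewrite ug cat_uniq => /esym/and3P[].
rewrite /shift {shift pabc};
  case: x y z p e1 e2 e3 => [cx sx] [cy sy] [cz sz] [r t] /= e1 e2 e3 u6.
(* Two passages through the same double point are equal or opposite, so the distinctness of the six
   passages separates the three crossings. *)
have [xy yz xz] : [/\ cx != cy, cy != cz & cx != cz].
  move: u6; rewrite /opp /= !inE !negb_or !xpair_eqE.
  split; apply/eqP => E; subst.
    by move: u6; rewrite !eqxx; case: (sx) (sy) => [] [].
    by move: u6; rewrite !eqxx; case: (sy) (sz) => [] []; rewrite ?andbF.
  by move: u6; rewrite !eqxx; case: (sx) (sz) => [] []; rewrite ?andbF.
rewrite /opp /= in e1 *; rewrite !big_cons !big_nil.
rewrite !swap_shift_segment ?xpair_eqE ?(negbTE xy) ?(negbTE yz) ?(negbTE xz)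
  ?[cz == cx]eq_sym ?(negbTE xz) //.
have [->|rx] := eqVneq r cx.
  rewrite (negbTE xy) (negbTE xz) /= /sgn /=; move: e1; rewrite {}e3 {}e2.
  by case: (o1); case: (sx); case: (sy); case: (sz); case: (t).
have [->|ry] := eqVneq r cy.
  rewrite (negbTE yz) /= /sgn /=; move: e1; rewrite {}e3 {}e2.
  by case: (o1); case: (sx); case: (sy); case: (sz); case: (t).
rewrite /sgn /=; move: e1; rewrite {}e3 {}e2.
case: (r == cz); case: (o1); case: (sx); case: (sy); case: (sz); by case: (t).
Qed.

End UPolynomial.

(** * Gauss words of diagrams and invariance under the moves *)

Definition gauss (w : word) : seq passage := [seq x.1 | x <- w & lev x != Virt].

Lemma gauss_cat u v : gauss (u ++ v) = gauss u ++ gauss v.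
Proof. by rewrite /gauss filter_cat map_cat. Qed.

Lemma gauss_cons x w :
  gauss (x :: w) = if lev x != Virt then x.1 :: gauss w else gauss w.
Proof. by rewrite /gauss /=; case: ifP. Qed.

Lemma gauss_rev w : gauss (rev w) = rev (gauss w).
Proof. by rewrite /gauss filter_rev map_rev. Qed.

Lemma lev_bar x : (lev (bar x) != Virt) = (lev x != Virt).
Proof. by case: x => p [[]|]. Qed.

Lemma gauss_marked w : well_marked w -> gauss_code (gauss w).
Proof.
case/andP=> uw /allP bw; apply/andP; split.
  by apply: (subseq_uniq _ uw); apply: map_subseq; apply: filter_subseq.
apply/allP=> p /mapP[x]; rewrite mem_filter => /andP[cx xw] -> {p}.
by apply/mapP; exists (bar x); rewrite // mem_filter lev_bar cx bw.
Qed.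

Lemma gauss_modify T w : gauss (modify_word [::] T w) = gauss w.
Proof.
elim: w => //= x w IH; rewrite !gauss_cons IH.
by case: x => p [[]|]; rewrite /modify_letter /lev /crossing /=;
  case: (p.1 \in T).
Qed.

Lemma gauss_strand o x y : lev x != Virt -> lev y != Virt ->
  gauss (strand o x y) = segment o x.1 y.1.
Proof. by move=> cx cy; case: o; rewrite /strand !gauss_cons cx cy. Qed.

Section MoveInvariance.
Local Open Scope ring_scope.
Variable phi : int -> int.
Hypothesis phiN : forall z, phi (- z) = - phi z.

(** Each strand of the triangle carries at most one classical passage, so reversing it does not
    affect the Gauss word. This covers both VRIII and SV. *)
Lemma gauss_flip_virtual x y z w w' :
  (lev y = Virt) -> (lev z = Virt) -> flip_triangle x y z w w' ->
  gauss w' = gauss w.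
Proof.
move=> vy vz [o1 o2 o3 u0 u1 u2 u3 a b c _ _ _ pabc].
have vby : lev (bar y) = Virt by apply/eqP; rewrite -[_ == _]negbK lev_bar vy.
have vbz : lev (bar z) = Virt by apply/eqP; rewrite -[_ == _]negbK lev_bar vz.
have short s : s \in [:: a; b; c] -> rev (gauss s) = gauss s.
  rewrite (perm_mem pabc) !inE => /or3P[] /eqP->;
  rewrite /strand; [case: o1 pabc|case: o2 pabc|case: o3 pabc] => pabc;
  by rewrite !gauss_cons ?vy ?vz ?vby ?vbz /=; do ?case: ifP.
by rewrite !gauss_cat !gauss_rev !short ?inE ?eqxx ?orbT.
Qed.

Lemma upoly_bigon x y w w' : (lev x != Virt) = (lev y != Virt) ->
  well_marked w -> well_marked w' -> add_bigon x y w w' ->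
  upoly phi (gauss w') = upoly phi (gauss w).
Proof.
move=> lxy /gauss_marked gw /gauss_marked/andP[uw' _] b.
have [vx|cx] := boolP (lev x != Virt); last first.
  by case: b => u v t _;
    rewrite !gauss_cat !gauss_cons !lev_bar -lxy (negbTE cx).
have vy : lev y != Virt by rewrite -lxy.
case: b gw uw' => u v t sxy;
  rewrite !gauss_cat !gauss_cons !lev_bar vx vy => gw uw'.
- exact: (@upoly_insert2 phi phiN _ _ _ _ _ true).
- exact: (@upoly_insert2 phi phiN _ _ _ _ _ false).
Qed.

Lemma upoly_monogon x w w' :
  well_marked w -> well_marked w' -> add_monogon x w w' ->
  upoly phi (gauss w') = upoly phi (gauss w).
Proof.
move=> /gauss_marked gw /gauss_marked/andP[uw' _] b.
case: b gw uw' => u v; rewrite !gauss_cat !gauss_cons !lev_bar.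
by case: (lev x != Virt) => // gw uw'; exact: upoly_insert1.
Qed.

Lemma upoly_isotopy w w' : well_marked w -> isotopy w w' ->
  upoly phi (gauss w') = upoly phi (gauss w) \/
  upoly phi (gauss w') = - upoly phi (gauss w).
Proof.
move=> /gauss_marked gw b; case: b gw => {w w'} [h w hI|u v x y _|u v x _] gw.
- left; rewrite -(upoly_relabel phi (gauss w) hI); congr upoly.
  by rewrite /gauss filter_map -!map_comp.
- by left; move: gw; rewrite !gauss_cat; exact: upoly_rot.
(* The new word is the reversal of [(x :: v) ++ u], a rotation of the old one. *)
- right; rewrite gauss_cat !gauss_rev -rev_cat -gauss_cat.
  rewrite gauss_cat in gw; rewrite !gauss_cat -(upoly_rot phi gw).
  by apply: upoly_rev; first exact: phiN;
    rewrite -(gauss_code_perm (g := gauss u ++ gauss (x :: v))) // perm_catC.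
Qed.

Lemma upoly_move w w' : well_marked w -> well_marked w' -> move w w' ->
  upoly phi (gauss w') = upoly phi (gauss w) \/
  upoly phi (gauss w') = - upoly phi (gauss w).
Proof.
move=> mw mw' [].
- exact: upoly_isotopy.
- by move=> x _ b; left; apply: upoly_monogon b.
- by move=> x _ b; left; apply: upoly_monogon b.
- by move=> x y _ xy b; left; apply: upoly_bigon b; rewrite ?xy.
- by move=> x y vx vy b; left; apply: upoly_bigon b; rewrite ?vx ?vy.
- move=> x y z [cx cy cz] _ b; left;
  case: b mw mw' => o1 o2 o3 u0 u1 u2 u3 a b c.
  move=> e2 e3 e1 pabc /gauss_marked/andP[ug _] _.
  rewrite !gauss_cat !gauss_rev in ug *.
  apply: (@upoly_flip _ x.1 y.1 z.1 o1 o2 o3) => //.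
  by have := perm_map gauss pabc; rewrite /= !gauss_strand ?lev_bar.
- by move=> x y z [_ vy vz] b; left; rewrite (gauss_flip_virtual vy vz b).
- by move=> x y z [_ vy vz] b; left; rewrite (gauss_flip_virtual vy vz b).
Qed.

End MoveInvariance.

(** * Counting regions *)

Section Cycles.
Variable T : eqType.
Implicit Types (f : T -> T) (s u v w : seq T) (C : seq (seq T)).

Lemma flatten_uniq_inj C c c' x : uniq (flatten C) ->
  c \in C -> c' \in C -> x \in c -> x \in c' -> c = c'.
Proof.
elim: C => //= a C IH; rewrite cat_uniq => /and3P[_ /hasPn aC uC].
have nx b : b \in C -> x \in b -> x \notin a.
  by move=> bC xb; apply: aC; apply/flattenP; exists b.
rewrite !in_cons => /orP[/eqP-> | cC] /orP[/eqP-> | c'C] xc xc' //.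
- by have := nx _ c'C xc'; rewrite xc.
- by have := nx _ cC xc; rewrite xc'.
- exact: IH.
Qed.

Lemma flatten_uniq C : [::] \notin C -> uniq (flatten C) -> uniq C.
Proof.
elim: C => //= a C IH; rewrite in_cons negb_or cat_uniq eq_sym.
case/andP=> an nC /and3P[_ /hasPn aC uC]; rewrite IH // andbT.
apply/negP => axC; case: a an aC axC => // x a _ aC axC.
have /aC/= : x \in flatten C by apply/flattenP; exists (x :: a);
  rewrite ?mem_head.
by rewrite mem_head.
Qed.

Lemma mem_fcycle_traject f c x n : fcycle f c -> x \in c -> size c <= n ->
  traject f x n =i c.
Proof.
move=> fc xc le_n y; apply/idP/idP.
  case/trajectP=> i _ ->; elim: i => //= i IH; exact: mem_fcycle.
case: (rot_to xc) => i c' Ec; rewrite -(mem_rot i) Ec.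
have: fcycle f (x :: c') by rewrite -Ec rot_cycle.
rewrite /= rcons_path => /andP[/fpathE Ec' _].
have -> : x :: c' = traject f x (size c) by rewrite -(size_rot i) Ec /= -Ec'.
by rewrite -(take_traject f x le_n); apply: mem_take.
Qed.

Lemma next_mid u x y v : uniq (u ++ x :: y :: v) ->
  next (u ++ x :: y :: v) x = y.
Proof.
rewrite next_nth mem_cat mem_head orbT cat_uniq /= negb_or.
case: u => [|z u] /and3P[_ /andP[xu _] _] /=; first by rewrite eqxx.
move: xu; rewrite in_cons negb_or eq_sym => /andP[/negbTE-> xu].
rewrite index_cat (negbTE xu) /= eqxx addn0.
by rewrite -cat_rcons nth_cat size_rcons ltnn subnn.
Qed.

Lemma prev_mid u x y v : uniq (u ++ x :: y :: v) ->
  prev (u ++ x :: y :: v) y = x.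
Proof. by move=> uf; rewrite -{2}(next_mid uf) prev_next. Qed.

Lemma next_rcons_cat s l w x : uniq (rcons s l ++ w) -> x \in s ->
  next (rcons s l ++ w) x = next (rcons s l) x.
Proof.
move=> us xs; have us' : uniq (rcons s l) by move: us;
  rewrite cat_uniq => /and3P[].
case/splitPr: xs us us' => s1 s2; rewrite -!cats1.
rewrite -!catA !cat_cons; case: s2 => [|y s2] us us'; by rewrite !next_mid.
Qed.

(** After a rotation the old cyclic word ends with [l] and [w] is appended to it, so only the
    successor of [l] can change. *)
Lemma next_insert u l w r v x : uniq (u ++ l :: w ++ r :: v) ->
  x \in u ++ l :: r :: v -> x != l ->
  next (u ++ l :: w ++ r :: v) x = next (u ++ l :: r :: v) x.
Proof.
have E s : u ++ l :: s = rcons u l ++ s by rewrite cat_rcons.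
have E0 : rcons ((r :: v) ++ u) l = (r :: v) ++ rcons u l by rewrite rcons_cat.
have E1 : rcons ((r :: v) ++ u) l ++ w = (r :: v) ++ (rcons u l ++ w).
  by rewrite E0 -catA.
rewrite !E catA => uf xf xl.
have uf0 : uniq (rcons u l ++ r :: v).
  by apply: subseq_uniq uf; apply: cat_subseq => //; apply: prefix_subseq.
rewrite -(next_rot (size (rcons u l ++ w)) uf) rot_size_cat -E1.
rewrite -(next_rot (size (rcons u l)) uf0) rot_size_cat -E0.
apply: next_rcons_cat; first by rewrite E1 uniq_catC.
move: xf; rewrite -cats1 -catA !mem_cat mem_seq1 (negbTE xl) /=.
by rewrite orbC.
Qed.

Lemma uniq_insert u l w r v :
  uniq (u ++ l :: w ++ r :: v) -> uniq (u ++ l :: r :: v).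
Proof.
move/subseq_uniq; apply; apply: cat_subseq => //=; rewrite eqxx.
exact: suffix_subseq.
Qed.

Lemma prev_insert u l w r v x : uniq (u ++ l :: w ++ r :: v) ->
  x \in u ++ l :: r :: v -> x != r ->
  prev (u ++ l :: w ++ r :: v) x = prev (u ++ l :: r :: v) x.
Proof.
move=> uf xf xr.
have uf0 := uniq_insert uf.
have xl : prev (u ++ l :: r :: v) x != l.
  apply: contraNneq xr => E.
  by rewrite -(next_prev uf0 x) E next_mid.
by rewrite -{1}(next_prev uf0 x) -(next_insert uf) ?mem_prev // prev_next.
Qed.

(* The cycles of f' are obtained from those of f by replacing each point z with
   the non-empty sequence hd z :: tl z. *)
Lemma fpath_subst f f' (hd : T -> T) (tl : T -> seq T) x s y :
  (forall z, z \in x :: s -> fpath f' (hd z) (rcons (tl z) (hd (f z)))) ->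
  fpath f x (rcons s y) ->
  fpath f' (hd x) (rcons (tl x ++ flatten [seq hd z :: tl z | z <- s]) (hd y)).
Proof.
elim: s x => [|z s IH] x hs /=.
  by rewrite andbT cats0 => /eqP<-; apply: hs; rewrite mem_head.
case/andP=> /eqP fx fs; rewrite rcons_cat /= -cat_rcons cat_path.
rewrite last_rcons -fx hs ?mem_head //= fx; apply: IH fs => t ts.
by apply: hs; rewrite in_cons ts orbT.
Qed.

Lemma fcycle_subst f f' (hd : T -> T) (tl : T -> seq T) c :
  {in c, forall z, fpath f' (hd z) (rcons (tl z) (hd (f z)))} ->
  fcycle f c -> fcycle f' (flatten [seq hd z :: tl z | z <- c]).
Proof. by case: c => //= x s hs; apply: fpath_subst. Qed.

End Cycles.

Section Faces.
Implicit Types (f : seq passage) (C : seq (seq dart)).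

(** A certificate for the regions: a partition of the darts into orbits of [turn]. It allows regions
    to be counted for words of symbolic length, where [nfaces] cannot be evaluated. *)
Definition face_cycles f C :=
  [/\ perm_eq (flatten C) (darts f), all (fcycle (turn f)) C & [::] \notin C].

Lemma darts_cat u v : darts (u ++ v) = darts u ++ darts v.
Proof. exact: allpairs_cat. Qed.

Lemma darts_cons p v : darts (p :: v) = [:: (p, true), (p, false) & darts v].
Proof. by []. Qed.

Lemma mem_darts f d : (d \in darts f) = (d.1 \in f).
Proof.
case: d => q b; elim: f => //= p f IH; rewrite darts_cons !inE {}IH !xpair_eqE.
by case: b; rewrite ?andbT ?andbF.
Qed.

Lemma uniq_darts f : uniq f -> uniq (darts f).
Proof.
by move=> uf; apply: allpairs_uniq => // -[p b] [q c] _ _ [-> ->].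
Qed.

(** A cycle is identified by the position of its first dart in [darts f]; disjoint non-empty cycles
    get different positions. *)
Lemma nfaces_cycles f C : uniq f -> face_cycles f C -> nfaces f = size C.
Proof.
move=> uf [pC fC nC].
have uC : uniq (flatten C) by rewrite (perm_uniq pC) uniq_darts.
have faceE c d : c \in C -> d \in c -> face f d =i c.
  move=> cC dc; apply: mem_fcycle_traject => //; first exact: (allP fC).
  rewrite -(perm_size pC); case/splitPr: cC => C1 C2.
  by rewrite flatten_cat !size_cat addnCA leq_addr.
have findE c d : c \in C -> d \in c ->
    find (mem (face f d)) (darts f) = find (mem c) (darts f).
  by move=> cC dc; apply: eq_find => e /=; apply: faceE.
have hasC c : c \in C -> has (mem c) (darts f).
  case: c => [|d c] cC; first by rewrite cC in nC.
  apply/hasP; exists d; rewrite /= ?mem_head // -(perm_mem pC).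
  by apply/flattenP; exists (d :: c); rewrite ?mem_head.
rewrite -(size_map (fun c => find (mem c) (darts f))).
apply/perm_size/uniq_perm; first exact: undup_uniq.
  rewrite map_inj_in_uniq ?flatten_uniq // => c c' cC c'C Ecc'.
  case: (darts f) (hasC _ cC) (hasC _ c'C) Ecc' => // d0 ds hc hc' Ecc'.
  have dc := nth_find d0 hc; have := nth_find d0 hc'; rewrite -Ecc' => dc'.
  exact: flatten_uniq_inj uC cC c'C dc dc'.
move=> n; rewrite mem_undup; apply/mapP/mapP.
  case=> d; rewrite -(perm_mem pC) => /flattenP[c cC dc] ->.
  by exists c; rewrite ?(findE c).
case=> c cC ->; case/hasP: (hasC c cC) => d df dc.
by exists d; rewrite ?(findE c).
Qed.

Lemma planar_cycles f C : uniq f -> face_cycles f C ->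
  size C = (size f)./2 + 2 -> planar f.
Proof.
by move=> uf fC szC; rewrite /planar (nfaces_cycles uf fC) szC eqxx orbT.
Qed.

(** Local surgery on a curve: the old regions survive with some boundary darts replaced by paths,
    and [N] lists the regions created. *)
Lemma face_cycles_subst f f' (hd : dart -> dart) (tl : dart -> seq dart) C N :
  face_cycles f C ->
  {in darts f, forall d, fpath (turn f') (hd d) (rcons (tl d) (hd (turn f d)))}
    ->
  all (fcycle (turn f')) N -> [::] \notin N ->
  perm_eq (flatten [seq hd d :: tl d | d <- darts f] ++ flatten N) (darts f') ->
  face_cycles f' ([seq flatten [seq hd d :: tl d | d <- c] | c <- C] ++ N).
Proof.
move=> [pC fC nC] hs fN nN pN; split.
- apply: perm_trans pN; rewrite flatten_cat perm_cat2r.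
  have := perm_flatten (perm_map (fun d => hd d :: tl d) pC); congr perm_eq.
  by elim: C {pC fC nC} => //= c C <-; rewrite map_cat flatten_cat.
- rewrite all_cat fN andbT all_map; apply/allP=> c cC /=.
  apply: (@fcycle_subst _ (turn f)); last exact: (allP fC).
  by move=> d dc; apply: hs; rewrite -(perm_mem pC); apply/flattenP; exists c.
- rewrite mem_cat negb_or nN andbT; apply/mapP=> -[[|d c] //= cC _].
  by rewrite cC in nC.
Qed.

End Faces.

Ltac perm_count := let i := fresh "i" in
  apply/permP=> i; rewrite !count_cat /=; rewrite ?count_cat /=;
  repeat match goal with
  | |- context [nat_of_bool (i ?d)] => move: (nat_of_bool (i d)) => ?
  | |- context [count i ?s] => move: (count i s) => ?
  end; clear; lia.

(** * Effect of two local insertions on the regions *)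

Section Insertions.
Implicit Types (f u v A M B : seq passage) (C : seq (seq dart)).

Lemma turn_next f p : turn f (p, true) = (opp (next f p), (next f p).2).
Proof. by rewrite /turn /= eqb_id. Qed.

Lemma turn_prev f p : turn f (p, false) = (opp (prev f p), ~~ (prev f p).2).
Proof. by rewrite /turn /= eqbF_neg. Qed.

Lemma flatten_subst_id (hd : dart -> dart) (tl : dart -> seq dart) s :
  {in s, forall d, hd d :: tl d = [:: d]} ->
  flatten [seq hd d :: tl d | d <- s] = s.
Proof.
by move=> /eq_in_map->; rewrite flatten_map1 map_id.
Qed.

Lemma face_cycles_monogon u l r v x C : x.2 = false ->
  uniq (u ++ [:: l; x; opp x; r] ++ v) ->
  face_cycles (u ++ [:: l; r] ++ v) C ->
  exists2 C', face_cycles (u ++ [:: l; x; opp x; r] ++ v) C'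
            & size C' = (size C).+1.
Proof.
move=> x2 uf fC; set f := u ++ [:: l; r] ++ v in fC; set f' := u ++ _ in uf *.
have nl : next f' l = x by exact: next_mid.
have px : prev f' x = l by exact: prev_mid.
have Ex : f' = rcons u l ++ x :: opp x :: r :: v by rewrite cat_rcons.
have Eo : f' = (rcons u l ++ [:: x]) ++ opp x :: r :: v by rewrite Ex -catA.
have nx : next f' x = opp x by rewrite Ex in uf *; exact: next_mid.
have po : prev f' (opp x) = x by rewrite Ex in uf *; exact: prev_mid.
have no : next f' (opp x) = r by rewrite Eo in uf *; exact: next_mid.
have pr : prev f' r = opp x by rewrite Eo in uf *; exact: prev_mid.
have uf0 : uniq f := uniq_insert (w := [:: x; opp x]) uf.
have nl0 : next f l = r by exact: next_mid.
have pr0 : prev f r = l by exact: prev_mid.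
(* The side [x.2 = false] puts the inside of the loop on its right, bounded by [(x, true)] alone.
   The region on the right of the edge from [l] to [r] now runs around the outside of the loop; the
   one on its left gains one dart. *)
pose tl d := if d == (l, true) then [:: (opp x, false); (opp x, true)]
             else if d == (r, false) then [:: (x, false)] else [::].
pose hd (d : dart) := d.
eexists; first apply: (@face_cycles_subst f f' hd tl C [:: [:: (x, true)]]) =>
  //.
- case=> p b; rewrite mem_darts /= => pf.
  have [[-> ->]|pl] := (p, b) =P (l, true).
    rewrite /tl eqxx /hd /= !(turn_next, turn_prev) nl po no nl0.
    by rewrite x2 !eqxx.
  have [[-> ->]|qr] := (p, b) =P (r, false).
    rewrite /tl xpair_eqE andbF eqxx /hd /= !(turn_next, turn_prev) pr pr0 oppK.
    by rewrite px /= x2 !eqxx.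
  rewrite /tl; move/eqP/negbTE: (pl) => ->; move/eqP/negbTE: (qr) => -> /=.
  rewrite andbT; case: b pl qr => pl qr.
    rewrite !turn_next (@next_insert _ u l [:: x; opp x] r v) //.
    by apply: contra_notN pl => /eqP->.
  rewrite !turn_prev (@prev_insert _ u l [:: x; opp x] r v) //.
  by apply: contra_notN qr => /eqP->.
- by rewrite /= turn_next nx oppK /= x2 eqxx.
- rewrite /f /f' !darts_cat !map_cat !flatten_cat /=.
  have uv p : p \in u ++ v -> (p == l) || (p == r) = false.
    have := uf0; rewrite /f uniq_catCA cat_uniq => /and3P[_ /hasPn h _] /h.
    by rewrite /= !inE => /negbTE.
  have idu s : {subset s <= u ++ v} -> 
      flatten [seq hd d :: tl d | d <- darts s] = darts s.
    move=> su; apply: flatten_subst_id => -[p b]; rewrite mem_darts => /su/uv.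
    by rewrite /tl /hd !xpair_eqE; do 2 case: eqP => //=.
  rewrite !idu; [|by move=> p pu; rewrite mem_cat pu ?orbT..].
  rewrite /tl /hd !xpair_eqE !eqxx /= !andbF /=.
  have /negbTE lr : r != l.
    by move: uf0; rewrite /f uniq_catCA /= inE negb_or eq_sym => /andP[/andP[]].
  by rewrite [l == r]eq_sym lr /=; perm_count.
- by rewrite size_cat size_map addn1.
Qed.

Lemma next_prev_mid f u x y v : uniq f -> f = u ++ x :: y :: v ->
  next f x = y /\ prev f y = x.
Proof. by move=> uf Ef; rewrite Ef in uf *; rewrite next_mid ?prev_mid. Qed.

(* The feeler x, y grows from the edge between a and b through the region that
   it shares with the edge between opp b and r, and enters the loop made there
   at z.  The dart (opp b, true) leaves the boundary of this region for that of
   a new one, hence the choice of hd. *)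
Lemma face_cycles_feeler A M B a b r x y z C
    (f := A ++ [:: a; b] ++ M ++ [:: opp b; r] ++ B)
    (f' := A ++ [:: a; x; y; b] ++ M
             ++ [:: opp b; z; opp x; opp y; opp z; r] ++ B) :
  b.2 = true -> x.2 = false -> y.2 = true -> z.2 = false -> uniq f' ->
  face_cycles f C -> exists2 C', face_cycles f' C' & size C' = size C + 3.
Proof.
move=> b2 x2 y2 z2 uf' fC; pose c := opp b.
pose W := A ++ [:: a; x; y; b] ++ M.
have EW s : W ++ s = A ++ [:: a; x; y; b] ++ M ++ s by rewrite -!catA.
have [na px] := @next_prev_mid f' A a x _ uf' erefl.
have [nx py] := @next_prev_mid f' (A ++ [:: a]) x y _ uf' (catA A [:: a] _).
have [ny pb] := @next_prev_mid f' (A ++ [:: a; x]) y b _ uf' (catA A [:: a;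
  x] _).
have [nc pz] := @next_prev_mid f' W c z _ uf' (esym (EW _)).
have Ec s t : A ++ [:: a; x; y; b] ++ M ++ s ++ t = (W ++ s) ++ t.
  by rewrite -catA EW.
have [nz pox] := @next_prev_mid f' (W ++ [:: c]) z (opp x) _ uf' (Ec [:: c] _).
have [nox poy] := @next_prev_mid f' (W ++ [:: c; z]) (opp x) (opp y) _ uf'
  (Ec [:: c; z] _).
have [noy poz] := @next_prev_mid f' (W ++ [:: c; z;
  opp x]) (opp y) (opp z) _ uf'
  (Ec [:: c; z; opp x] _).
have [noz pr] := @next_prev_mid f' (W ++ [:: c; z; opp x;
  opp y]) (opp z) r _ uf'
  (Ec [:: c; z; opp x; opp y] _).
pose f1 := A ++ [:: a; b] ++ M ++ [:: c; z; opp x; opp y; opp z; r] ++ B.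
have uf1 : uniq f1 by exact: (uniq_insert (w := [:: x; y]) uf').
pose W1 := A ++ [:: a; b] ++ M.
have EW1 s : A ++ [:: a; b] ++ M ++ s = W1 ++ s by rewrite -!catA.
have uf : uniq f.
  rewrite /f1 EW1 in uf1; rewrite /f EW1.
  exact: (uniq_insert (w := [:: z; opp x; opp y; opp z]) uf1).
have [na0 pb0] := @next_prev_mid f A a b _ uf erefl.
have [nc0 pr0] := @next_prev_mid f W1 c r _ uf (EW1 _).
have next_f' p : p \in f -> p != a -> p != c -> next f' p = next f p.
  move=> pf pa pc; have pf1 : p \in f1.
    move: pf; rewrite /f /f1 !EW1 !mem_cat !inE.
    by case/or3P=> [-> //|/orP[]->|->]; rewrite ?orbT.
  rewrite /f' (@next_insert _ A a [:: x; y] b) // -/f1.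
  rewrite /f /f1 !EW1 in pf uf1 *.
  exact: (@next_insert _ W1 c [:: z; opp x; opp y; opp z] r).
have prev_f' p : p \in f -> p != b -> p != r -> prev f' p = prev f p.
  move=> pf pa pc; have pf1 : p \in f1.
    move: pf; rewrite /f /f1 !EW1 !mem_cat !inE.
    by case/or3P=> [-> //|/orP[]->|->]; rewrite ?orbT.
  rewrite /f' (@prev_insert _ A a [:: x; y] b) // -/f1.
  rewrite /f /f1 !EW1 in pf uf1 *.
  exact: (@prev_insert _ W1 c [:: z; opp x; opp y; opp z] r).
pose hd d := if d == (c, true) then (opp x, false) else d.
pose tl d := if d == (c, true) then [:: (opp z, true)]
  else if d == (b, false) then [:: (opp y, false); (x, false)]
  else if d == (r, false) then [:: (z, false)] else [::].
have : uniq ([:: a; b; c; r] ++ (A ++ M ++ B)).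
  have /perm_uniq<- // : perm_eq f ([:: a; b; c; r] ++ (A ++ M ++ B)).
    by rewrite /f; perm_count.
rewrite cat_uniq => /and3P[u4 /hasPn dis _]; move: u4.
rewrite /= !inE !negb_or !andbT => /and3P[/and3P[ab ac ar] /andP[bc br] cr].
have hd_id d : d != (c, true) -> hd d = d by rewrite /hd => /negbTE->.
have opp_c p e : p != b -> hd (opp p, e) = (opp p, e).
  by move=> pb'; rewrite hd_id // xpair_eqE /c (inj_eq (inv_inj oppK)) (negbTE
    pb').
(* The new regions are, in order: the rest of the inside of the loop, the bigon cut off there by the
   tip of the feeler, and the corner of the old region at [b] that the feeler separates. *)
eexists; first apply: (@face_cycles_subst f f' hd tl C
   [:: [:: (x, true); (opp y, true); (z, true)];
       [:: (y, false); (opp x, true)];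
       [:: (c, true); (opp z, false); (y, true)]]) => //.
- case=> p e; rewrite mem_darts /= => pf.
  have [[-> ->]|pc] := (p, e) =P (c, true).
    rewrite /tl /hd eqxx /= -/(hd _) !(turn_next, turn_prev) nc0 opp_c 1?eq_sym
      //.
    by rewrite pox noz z2 !eqxx.
  have [[-> ->]|qb] := (p, e) =P (b, false).
    rewrite /tl hd_id ?xpair_eqE ?andbF //= !eqxx /= !(turn_next, turn_prev).
    by rewrite pb0 opp_c // pb poy px oppK /= y2 x2 !eqxx.
  have [[-> ->]|qr] := (p, e) =P (r, false).
    rewrite /tl hd_id ?xpair_eqE ?andbF //= (eq_sym r b) (negbTE br) !eqxx /=.
    rewrite !(turn_next, turn_prev) pr0 pr pz oppK hd_id; last first.
      by rewrite oppK xpair_eqE (negbTE bc).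
    by rewrite !oppK /= z2 b2 !eqxx.
  have -> : tl (p, e) = [::] by rewrite /tl; do 3 case: eqP => //.
  rewrite hd_id /=; last exact/eqP.
  have [[-> ->]|pa] := (p, e) =P (a, true).
    by rewrite !turn_next na na0 /hd b2 eqxx x2 eqxx.
  have -> : hd (turn f (p, e)) = turn f (p, e).
    apply: hd_id; apply/negP; case: e pa {pc qb qr} => pa;
      rewrite ?turn_next ?turn_prev xpair_eqE /c (inj_eq (inv_inj oppK)).
      by case/andP=> /eqP Eb _; case: pa; rewrite -[p](prev_next uf) Eb pb0.
    by case/andP=> /eqP->; rewrite b2.
  rewrite andbT; case: e pc qb qr pa => pc qb qr pa.
    rewrite !turn_next next_f' //; first by apply: contra_notN pa => /eqP->.
    by apply: contra_notN pc => /eqP->.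
  rewrite !turn_prev prev_f' //; first by apply: contra_notN qb => /eqP->.
  by apply: contra_notN qr => /eqP->.
- rewrite /= !(turn_next, turn_prev) nx noy nz py nox nc poz ny !oppK /=.
  by rewrite x2 y2 z2 b2 !eqxx.
- rewrite /f /f' !darts_cat !map_cat !flatten_cat /=.
  have idu s : {subset s <= A ++ M ++ B} ->
      flatten [seq hd d :: tl d | d <- darts s] = darts s.
    move=> su; apply: flatten_subst_id => -[p e]; rewrite mem_darts => /su pf.
    have : p \notin [:: a; b; c; r] by exact: dis.
    rewrite !inE !negb_or => /and4P[_ /negbTE nb /negbTE nc' /negbTE nr].
    by rewrite /tl /hd !xpair_eqE nb nc' nr.
  rewrite !idu; [|by move=> p pu; rewrite !mem_cat pu ?orbT..].
  rewrite /tl /hd -/c !xpair_eqE !eqxx /= !andbF /=.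
  rewrite (negbTE ab) (negbTE ac) (negbTE ar) (negbTE bc) (negbTE cr).
  rewrite [c == b]eq_sym [r == c]eq_sym [r == b]eq_sym.
  by rewrite (negbTE bc) (negbTE br) (negbTE cr) /=; perm_count.
- by rewrite size_cat size_map.
Qed.

End Insertions.

(** * The family of knots *)

Section NestedChords.
Local Open Scope ring_scope.
Variable phi : int -> int.

Lemma balance_negative s : {in s, forall p, p.2 = false} ->
  balance s = - (size s)%:Z.
Proof.
elim: s => [|p s IH] hs; first exact: big_nil.
rewrite balance_cons IH => [|q qs]; last by rewrite hs // in_cons qs orbT.
by rewrite /sgn hs ?mem_head //=; lia.
Qed.

Lemma height_map_opp s p : height (map opp s) (opp p) = - height s p.
Proof.
by elim: s => //= q s ->; rewrite (inj_eq (inv_inj oppK)) sgn_opp; case: eqP;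
  lia.
Qed.

(** The chord of [x] crosses every chord of [s], all in the same direction, hence has index
    [size s]. The chords of [s] are nested in one another and cross only that of [x], hence have
    index -1. *)
Lemma upoly_nested x s (g := x :: s ++ opp x :: rev (map opp s)) :
  {in x :: s, forall p, p.2 = false} -> uniq g ->
  upoly phi g = phi (size s)%:Z + (size s)%:Z * phi (- 1).
Proof.
move=> xs2 ug; have x2 : x.2 = false by rewrite xs2 ?mem_head.
have s2 : {in s, forall p, p.2 = false}.
  by move=> p ps; rewrite xs2 // in_cons ps orbT.
have [n En] : exists n : int, n = (size s)%:Z by exists (size s)%:Z.
have bs : balance s = - n by rewrite En balance_negative.
rewrite -En; have bxs : balance (x :: s) = - 1 - n.
  by rewrite balance_cons bs /sgn x2.
have Eg : g = (x :: s) ++ opp x :: rev (map opp s) by [].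
have hox : height g (opp x) = - 1 - n by rewrite -bxs Eg height_mid -?Eg.
have ox2 : (opp x).2 by rewrite /= x2.
rewrite /upoly /g big_cons x2 big_cat big_cons ox2 /=.
rewrite [X in X + _]big_seq_cond big1 ?add0r => [|p /andP[/s2->] //].
congr (_ + _).
  rewrite /chord_index oppK -/g hox /g /= eqxx; congr phi; lia.
rewrite (perm_big (map opp s)) ?perm_rev //= big_map big_seq_cond.
rewrite (eq_bigr (fun=> phi (- 1))); last first.
  move=> p /andP[ps _]; congr phi; rewrite /chord_index oppK -/g.
  have px : p != x by apply: contraTneq ps => ->; case/andP: ug;
    rewrite mem_cat => /norP[].
  have sp : opp p \notin x :: s.
    by apply/negP => /xs2 /=; rewrite s2.
  have us : uniq (map opp s).
    by move: ug; rewrite Eg cat_uniq => /and3P[_ _ /= /andP[_]];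
      rewrite rev_uniq.
  have -> : height g p = - 1 + height s p.
    by rewrite /g /= eq_sym (negbTE px) height_cat ps /sgn x2.
  have -> : height g (opp p) = height s p - 1.
    rewrite Eg height_cat (negbTE sp) bxs /= (inj_eq (inv_inj oppK)) eq_sym.
    rewrite (negbTE px) height_rev ?map_f // height_map_opp balance_map_opp bs.
    by rewrite !sgn_opp /sgn x2 s2 //=; move: (height s p) => h; lia.
  by move: (height s p) => h; lia.
rewrite (eq_bigl (mem s)); last first.
  by move=> p /=; case: (boolP (p \in s)) => //= ps; rewrite s2.
rewrite -big_seq big_const_seq count_predT iter_addr addr0.
by rewrite -mulr_natl natz -En.
Qed.

End NestedChords.

(** * The spiral curves and their planarity *)

Definition tip_in k : passage := (3 * k, false).
Definition tip_out k : passage := ((3 * k).+1, true).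
Definition turn_in k : passage := ((3 * k).+2, false).

Fixpoint finger k : seq passage :=
  if k is j.+1 then rcons (finger j) (tip_in j) else [::].

(** This unfolds to the way back of the finger, [tip_out (k - 1)] to [tip_out 0], followed by the
    turns from the outermost inwards. The crossing of [turn_in j] is the e_j of the overview. *)
Fixpoint spiral k : seq passage :=
  if k is j.+1 then
    tip_out j :: spiral j ++ [:: turn_in j; opp (tip_in j); opp (tip_out j)]
  else [::].

Fixpoint spoke k : seq passage :=
  if k is j.+1 then opp (turn_in j) :: spoke j else [::].

Definition curve k := finger k ++ spiral k ++ spoke k.

(** Halfway between [curve k] and [curve k.+1]: the loop at the centre has been added, but the
    finger does not enter it yet. *)
Definition curled_curve k :=
  finger k ++ spiral k ++ [:: turn_in k; opp (turn_in k)] ++ spoke k.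

Definition layer k := [:: tip_in k; tip_out k; turn_in k;
  opp (tip_in k); opp (tip_out k); opp (turn_in k)].

(** The shape required by [face_cycles_feeler], with the tip of the finger as the edge from [a] to
    [b]. *)
Lemma curveS k : curve k.+1 =
  finger k ++ [:: tip_in k; tip_out k]
  ++ (spiral k ++ [:: turn_in k; opp (tip_in k)])
  ++ [:: opp (tip_out k); opp (turn_in k)] ++ spoke k.
Proof. by rewrite /curve /= cat_rcons -!catA. Qed.

Lemma perm_curveS k : perm_eq (curve k.+1) (layer k ++ curve k).
Proof. rewrite curveS /curve; perm_count. Qed.

Lemma curve_bound k p : p \in curve k -> p.1 < 3 * k.
Proof.
elim: k => // k IH; rewrite (perm_mem (perm_curveS k)) mem_cat.
case/orP=> [|/IH]; last by lia.
by rewrite !inE => /or4P[|||/or3P[]] /eqP-> /=; lia.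
Qed.

Lemma curve_gauss k : gauss_code (curve k).
Proof.
elim: k => // k IH; rewrite (gauss_code_perm (perm_curveS k)).
have dis p : p \in curve k -> p \notin layer k.
  move=> /curve_bound lt; apply/negP; rewrite !inE.
  by case/or4P=> [|||/or3P[]] /eqP Ep; move: lt; rewrite Ep /=; lia.
case/andP: IH => uk /allP ok; apply/andP; split.
  rewrite cat_uniq uk andbT; apply/andP; split.
    rewrite /layer /tip_in /tip_out /turn_in /opp /=; move: (3 * k) => n.
    by rewrite !inE !xpair_eqE /= !andbF !andbT /= !orbF; lia.
  by apply/hasPn => p; exact: dis.
rewrite all_cat; apply/andP; split.
  apply/allP=> p; rewrite mem_cat /layer !inE => pin; apply/orP; left.
  by case/or4P: pin => [|||/or3P[]] /eqP->; rewrite ?oppK eqxx ?orbT.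
by apply/allP=> p pk; rewrite mem_cat ok ?orbT.
Qed.

Lemma curve_uniq k : uniq (curve k). Proof. by case/andP: (curve_gauss k). Qed.

Lemma size_curve k : size (curve k) = 6 * k.
Proof.
elim: k => // k IH; rewrite (perm_size (perm_curveS k)) size_cat IH /=; lia.
Qed.

Lemma curve_faces k :
  exists2 C, face_cycles (curve k.+1) C & size C = 3 * k + 5.
Proof.
elim: k => [|k [C fC szC]].
  (* The induction starts at [curve 1], the first curve with a finger to extend: 3 crossings, 6
     edges, 5 regions. Every later layer adds 3 crossings and 3 regions. *)
  by exists [:: [:: (tip_out 0, false); (opp (tip_in 0), true)];
    [:: (tip_in 0, true); (opp (tip_out 0), true); (turn_in 0, true)];
    [:: (tip_in 0, false); (turn_in 0, false); (opp (tip_out 0), false)];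
    [:: (opp (tip_in 0), false); (opp (turn_in 0), true)];
    [:: (tip_out 0, true); (opp (turn_in 0), false)]].
rewrite curveS in fC.
have Ek : curve k.+2 = finger k ++ [:: tip_in k; tip_in k.+1; tip_out k.+1;
  tip_out k]
  ++ (spiral k ++ [:: turn_in k; opp (tip_in k)])
  ++ [:: opp (tip_out k); turn_in k.+1; opp (tip_in k.+1); opp (tip_out k.+1);
      opp (turn_in k.+1); opp (turn_in k)] ++ spoke k.
  by rewrite /curve /= !cat_rcons -!catA /= -?catA.
have := curve_uniq k.+2; rewrite Ek => uk.
have [C' fC' szC'] :=
  @face_cycles_feeler _ _ _ (tip_in k) (tip_out k)
  (opp (turn_in k)) (tip_in k.+1) (tip_out k.+1) (turn_in k.+1) C
  erefl erefl erefl erefl uk fC.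
by exists C'; rewrite // szC' szC; lia.
Qed.

Lemma curve_planar k : planar (curve k).
Proof.
case: k => // k; have [C fC szC] := curve_faces k.
by apply: planar_cycles fC _; rewrite ?curve_uniq // szC size_curve; lia.
Qed.

(** Deleting the four tip passages of layer [k] from [curve k.+1] leaves this word. *)
Lemma curled_curve_uniq k : uniq (curled_curve k).
Proof.
apply: subseq_uniq (curve_uniq k.+1); rewrite /curled_curve /curve /= cat_rcons.
rewrite -catA; apply: cat_subseq => //.
apply: (subseq_trans _ (suffix_subseq [:: tip_in k; tip_out k] _)).
apply: cat_subseq => //.
apply: (@cat_subseq _ [:: turn_in k] (opp (turn_in k) :: spoke k)
  [:: turn_in k; opp (tip_in k); opp (tip_out k)]); last exact: subseq_refl.
by rewrite /= eqxx.
Qed.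

Lemma curled_curve_planar k : planar (curled_curve k).
Proof.
case: k => // k; have [C fC szC] := curve_faces k.
rewrite curveS in fC.
pose u := finger k ++ [:: tip_in k; tip_out k] ++ spiral k
  ++ [:: turn_in k; opp (tip_in k)].
have Eu s : u ++ s = finger k ++ [:: tip_in k; tip_out k]
    ++ (spiral k ++ [:: turn_in k; opp (tip_in k)]) ++ s.
  by rewrite /u -!catA.
have Ek : curled_curve k.+1 = u ++ [:: opp (tip_out k); turn_in k.+1;
    opp (turn_in k.+1); opp (turn_in k)] ++ spoke k.
  by rewrite /curled_curve /u /= !cat_rcons -!catA /= -?catA.
have := curled_curve_uniq k.+1; rewrite -Eu in fC; rewrite Ek => uk.
have [C' fC' szC'] :=
  @face_cycles_monogon _ (opp (tip_out k))
  (opp (turn_in k)) _ (turn_in k.+1) C erefl uk fC.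
apply: planar_cycles fC' _ => //.
have -> : size (u ++ [:: opp (tip_out k); turn_in k.+1;
    opp (turn_in k.+1); opp (turn_in k)] ++ spoke k) = (size (curve k.+1)).+2.
  by rewrite curveS -Eu !size_cat /= !addnS.
by rewrite szC' szC size_curve; lia.
Qed.

(** * Diagrams carried by the curves, and their untangling *)

Definition mark (cl : pred nat) (p : passage) : letter :=
  (p, if cl p.1 then Some p.2 else None).

Lemma bar_mark cl p : bar (mark cl p) = mark cl (opp p).
Proof. by rewrite /bar /mark /=; case: (cl p.1). Qed.

Lemma shadow_mark cl f : shadow (map (mark cl) f) = f.
Proof. by rewrite /shadow -map_comp map_id. Qed.

Lemma mark_marked cl f : gauss_code f -> well_marked (map (mark cl) f).
Proof.
case/andP=> uf /allP of'; apply/andP; split; first by rewrite shadow_mark.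
by apply/allP=> _ /mapP[p pf ->]; rewrite bar_mark map_f ?of'.
Qed.

Lemma mark_planar cl f : planar f -> planar (shadow (map (mark cl) f)).
Proof. by rewrite shadow_mark. Qed.

Lemma gauss_mark cl f : gauss (map (mark cl) f) = [seq p <- f | cl p.1].
Proof.
rewrite /gauss filter_map -map_comp map_id; apply: eq_filter => p /=.
by rewrite /mark /lev /=; case: (cl p.1).
Qed.

Lemma diagram_inj D D' : code D = code D' -> D = D'.
Proof.
case: D D' => [w m p] [w' m' p'] /= E; case: w' / E m' p' => m' p'.
by rewrite (bool_irrelevance m m') (bool_irrelevance p p').
Qed.

Definition curve_diagram cl k : diagram :=
  Diagram (mark_marked cl (curve_gauss k)) (mark_planar cl (curve_planar k)).

Lemma curled_curve_gauss k : gauss_code (curled_curve k).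
Proof.
rewrite /gauss_code curled_curve_uniq /=; apply/allP=> p.
have mem q : (q \in curled_curve k) =
    (q \in [:: turn_in k; opp (turn_in k)]) || (q \in curve k).
  by rewrite /curled_curve /curve !mem_cat; do !case: (q \in _).
rewrite !mem => /orP[|pk]; last first.
  by case/andP: (curve_gauss k) => _ /allP ->; rewrite ?orbT.
by rewrite !inE => /orP[] /eqP->; rewrite ?oppK eqxx ?orbT.
Qed.

Definition curled_diagram cl k : diagram :=
  Diagram (mark_marked cl (curled_curve_gauss k))
          (mark_planar cl (curled_curve_planar k)).

(* The crossings of layer k are called 3 * k, 3 * k + 1 and 3 * k + 2. *)
Definition is_turn c := c %% 3 == 2.

Lemma is_turnE k : (is_turn (3 * k) = false) * (is_turn (3 * k).+1 = false)
  * (is_turn (3 * k).+2 = true).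
Proof. rewrite /is_turn; do !split; lia. Qed.

Lemma curl_move k :
  move (curve_diagram is_turn k) (curled_diagram is_turn k).
Proof.
apply: (@RI _ _ (mark is_turn (turn_in k))).
  by rewrite /lev /mark /= is_turnE.
rewrite /= /curled_curve /curve !map_cat catA [X in add_monogon _ _ X]catA.
by rewrite /= -bar_mark; apply: AddMonogon.
Qed.

Lemma feeler_move k :
  move (curled_diagram is_turn k) (curve_diagram is_turn k.+1).
Proof.
apply: (@VRII _ _ (mark is_turn (tip_in k)) (mark is_turn (tip_out k))).
- by rewrite /lev /mark /= is_turnE.
- by rewrite /lev /mark /= is_turnE.
rewrite /= /curled_curve /curve /= cat_rcons /= !map_cat /= !map_cat /= -catA.
rewrite -!bar_mark.
have := @AddParallel (mark is_turn (tip_in k)) (mark is_turn (tip_out k))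
  (map (mark is_turn) (finger k))
  (map (mark is_turn) (spiral k) ++ [:: mark is_turn (turn_in k)])
  (bar (mark is_turn (turn_in k)) :: map (mark is_turn) (spoke k)) isT.
by rewrite -!catA.
Qed.

(** With the whole finger virtual, each layer arises from the previous one by one RI, creating the
    central loop, and one VRII, pushing the finger into it. *)
Lemma curve_trivial k : trivial_knot (curve_diagram is_turn k).
Proof.
rewrite /trivial_knot /=; elim: k => [|k IH].
  have -> : curve_diagram is_turn 0 = circle by exact: diagram_inj.
  exact: rst_refl.
apply: rst_trans IH _; apply: (@rst_trans _ _ _ (curled_diagram is_turn k)).
  by apply: rst_step; exact: curl_move.
by apply: rst_step; exact: feeler_move.
Qed.

(** * A numerical invariant separating the family *)

Definition bump (m : nat) (z : int) : int :=
  ((z == m%:Z)%:R - (z == - m%:Z)%:R)%R.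

Lemma bumpN m z : bump m (- z)%R = (- bump m z)%R.
Proof. by rewrite /bump eqr_oppLR eqr_opp opprB. Qed.

(** With [bump m] as odd function, [upoly] is the coefficient of degree [m] of the u-polynomial for
    positive [m]. The absolute value absorbs the sign due to reversing the curve. *)
Definition strength m (w : word) : nat := `|upoly (bump m) (gauss w)|%N.

Lemma strength_equivalent m (D D' : diagram) :
  equivalent D D' -> strength m D = strength m D'.
Proof.
elim=> // [{}D {}D' mv | D1 D2 D3 _ -> _ -> //].
rewrite /strength; have := upoly_move (@bumpN m) (code_marked D) (code_marked
  D') mv.
by case=> ->; rewrite ?abszN.
Qed.

Lemma trivial_strength m D : trivial_knot D -> strength m D = 0.
Proof.
by move=> /(strength_equivalent m) <-; rewrite /strength /upoly big_nil.
Qed.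

Lemma modify_strength m T (D : diagram) :
  strength m (modify [::] T D) = strength m D.
Proof. by rewrite /strength /= gauss_modify. Qed.

(** In [curve n.+1], [3 * n] names the crossing of [tip_in n], the crossing c of the overview. *)
Definition knotted_class n c := is_turn c || (c == 3 * n).

Definition knotted n := curve_diagram (knotted_class n) n.+1.

Lemma knotted_gauss n : gauss (knotted n) =
  let s := [seq turn_in j | j <- iota 0 n.+1] in
  tip_in n :: s ++ opp (tip_in n) :: rev (map opp s).
Proof.
have iotaS k : iota 0 k.+1 = iota 0 k ++ [:: k] by rewrite -addn1 iotaD.
have outE k : ((3 * k).+1 == 3 * n) = false by apply/eqP; lia.
have inE k : k < n -> (3 * k == 3 * n) = false by move=> lt; apply/eqP; lia.
pose P (p : passage) := knotted_class n p.1.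
have hf k : k <= n -> filter P (finger k) = [::].
  elim: k => //= k IH lk; rewrite filter_rcons IH 1?ltnW //.
  by rewrite /P /knotted_class /= is_turnE inE.
have hs k : k <= n -> filter P (spiral k) = [seq turn_in j | j <- iota 0 k].
  elim: k => // k IH lk; rewrite iotaS map_cat /= filter_cat IH 1?ltnW //=.
  rewrite /P /knotted_class /= !is_turnE /=.
  by rewrite outE inE.
have hp k : filter P (spoke k) = rev (map opp [seq turn_in j | j <- iota 0 k]).
  elim: k => // k IH; rewrite iotaS !map_cat rev_cat /= -IH.
  by rewrite /P /knotted_class /= is_turnE.
cbv zeta; rewrite gauss_mark -/P curveS !filter_cat hf // hs // hp.
rewrite iotaS !map_cat rev_cat /=.
rewrite /P /knotted_class /= !is_turnE !eqxx /=.
by rewrite outE -!catA.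
Qed.

(** For [m > 1] the chords of index -1 are invisible to [bump m], and only the special chord, of
    index [n.+1], can be detected. *)
Lemma knotted_strength m n : 1 < m -> strength m (knotted n) = (m == n.+1).
Proof.
move=> m1; have /andP[ug _] := gauss_marked (code_marked (knotted n)).
rewrite knotted_gauss /= in ug.
rewrite /strength knotted_gauss upoly_nested //; last first.
  by move=> p; rewrite in_cons => /orP[/eqP->|/mapP[j _ ->]].
have -> : bump m (-1)%R = 0%R.
  rewrite /bump; have -> : ((-1 == m%:Z)%R) = false by apply/eqP; lia.
  by have -> : ((-1 == - m%:Z)%R) = false by apply/eqP; lia.
rewrite mulr0 addr0 size_map size_iota /bump eqz_nat eq_sym.
have -> : ((n.+1%:Z == - m%:Z)%R) = false by apply/eqP; lia.
by rewrite subr0; case: eqP.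
Qed.

Local Open Scope classical_set_scope.

Theorem theorem3p2 :
  infinite_set
    [set K : set diagram | virtual_knot K /\ unknotting_index K (1, 0)].
Proof.
(* The shift to [n.+1] makes the index of the special chord at least 2; for [knotted 0] the
   contributions of indices 1 and -1 cancel. *)
pose knot n := [set D | equivalent (knotted n.+1) D].
have strength0 n D S T : knot n D -> size S = 0 -> trivial_knot (modify S T D)
  -> False.
  move=> nD /size0nil-> /(trivial_strength n.+2).
  rewrite modify_strength -(strength_equivalent _ nD) knotted_strength //.
  by rewrite eqxx.
(* In dictionary order [(1, 0)] is below every pair with positive first entry, so it suffices to
   exclude crossing changes alone. *)
have index_ge n D (q : nat *l nat) : knot n D -> unknottable D q.1 q.2 ->
    (((1, 0) : nat *l nat) <= q)%O.
  move=> nD [S [T [szS _ _ _ tr]]]; case: q szS => [[|q1] q2] /= szS.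
    by have := strength0 n D S T nD szS tr.
  by apply/andP; split=> //; apply/implyP.
have knotD n : knot n (knotted n.+1) by exact: rst_refl.
have unk n : unknottable (knotted n.+1) 1 0.
  exists [:: 3 * n.+1], [::]; split=> //.
    move=> c; rewrite cats0 mem_seq1 => /eqP->; apply/mapP.
    exists (mark (knotted_class n.+1) (opp (tip_in n.+1))) => //.
    rewrite mem_filter map_f; last first.
      by rewrite (perm_mem (perm_curveS _)) mem_cat /layer !inE eqxx !orbT.
    by rewrite /lev /= /knotted_class eqxx orbT.
  (* Virtualizing the special crossing leaves exactly the turn crossings classical. *)
  have -> : modify [:: 3 * n.+1] [::] (knotted n.+1) = curve_diagram is_turn
    n.+2.
    apply: diagram_inj; rewrite /= /modify_word -map_comp; apply: eq_map => p.
    rewrite /modify_letter /crossing /lev /mark /knotted_class /= mem_seq1.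
    by case: eqP => [->|_]; rewrite ?is_turnE ?orbF.
  exact: curve_trivial.
have idx n : unknotting_index (knot n) (1, 0).
  split=> [|q [D nD [uD _]]]; last exact: index_ge nD uD.
  exists (knotted n.+1) => //; split; first exact: unk.
  by move=> q /=; apply: index_ge.
(* The degree [n.+2] coefficient is non-zero, up to sign 1, for [knot n] only. *)
have knot_inj : injective knot.
  move=> n n' E; have := knotD n'; rewrite -E => /(strength_equivalent n.+2).
  by rewrite !knotted_strength // eqxx => /esym; case: eqP => // -[].
apply: (@sub_infinite_set _ (range knot)).
  by move=> _ [n _ <-]; split; [exists (knotted n.+1) | exact: idx].
rewrite (eq_finite_set (inj_card_eq (in2W knot_inj))).
exact: infinite_nat.
Qed.
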